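(* Let $d=2k$ be a fixed even positive integer and let $j$ be an integer with $k\leq j<2k$. Then there exist constants $\gamma_j(d),\Gamma_j(d)>0$ such that, as $n\to\infty$, $$\gamma_j(d)+o(1)\ \leq\ \frac{\mathrm{fmax}(d,n;j)}{\binom{n}{k}}\ \leq\ \Gamma_j(d)+o(1).$$
   Context: A polytope $P\subset\mathbb{R}^d$ is centrally symmetric if $P=-P$. $\mathrm{fmax}(d,n;j)$ denotes the maximum number of $j$-dimensional faces of a centrally symmetric $d$-dimensional polytope with $n$ vertices; it is defined for those $n$ for which such polytopes exist, and asymptotics are as $n\to\infty$ over such $n$. *)

(* Defs.v *)
From HB Require Import structures.
From mathcomp Require Export all_boot all_order all_algebra.
From mathcomp Require Export all_classical all_reals all_analysis.
Export Order.TTheory GRing.Theory Num.Theory.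
Export numFieldNormedType.Exports.

Set Implicit Arguments.
Unset Strict Implicit.
Unset Printing Implicit Defensive.

Local Open Scope classical_set_scope.
Local Open Scope card_scope.
Local Open Scope ring_scope.

Definition affine_hull (R : realType) (d : nat) (A : set 'rV[R]_d) :
    set 'rV[R]_d :=
  [set x | exists m (a : 'I_m -> R) (p : 'I_m -> 'rV[R]_d),
    [/\ forall i, A (p i), \sum_i a i = 1 & x = \sum_i a i *: p i]].

Definition convex_hull (R : realType) (d : nat) (A : set 'rV[R]_d) :
    set 'rV[R]_d :=
  [set x | exists m (a : 'I_m -> R) (p : 'I_m -> 'rV[R]_d),
    [/\ forall i, A (p i), forall i, 0 <= a i, \sum_i a i = 1
      & x = \sum_i a i *: p i]].

(* The empty set has no dimension in this sense. *)
Definition has_dim (R : realType) (d : nat) (A : set 'rV[R]_d) (j : nat) :=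
  exists (p : 'rV[R]_d) (U : {vspace 'rV[R]_d}),
    \dim U = j /\ affine_hull A = [set p + u | u in [set` U]].

Definition polytope (R : realType) (d : nat) (P : set 'rV[R]_d) :=
  exists2 V : set 'rV[R]_d, finite_set V & P = convex_hull V.

Definition centrally_symmetric (R : realType) (d : nat) (P : set 'rV[R]_d) :=
  P = [set - x | x in P].

(* The case a = 0 makes P itself and the empty set faces of P. *)
Definition is_face (R : realType) (d : nat) (P F : set 'rV[R]_d) :=
  exists (a : 'cV[R]_d) (c : R),
    (forall x, P x -> (x *m a) 0 0 <= c) /\
    F = P `&` [set x | (x *m a) 0 0 = c].

Definition faces (R : realType) (d : nat) (P : set 'rV[R]_d) (j : nat) :
    set (set 'rV[R]_d) :=
  [set F | is_face P F /\ has_dim F j].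

(* The vertices of P are counted as its 0-dimensional faces. *)
Definition cs_polytope (R : realType) (d n : nat) (P : set 'rV[R]_d) :=
  [/\ polytope P, has_dim P d, centrally_symmetric P & faces P 0 #= `I_n].

Definition face_numbers (R : realType) (d n j : nat) : set nat :=
  [set m | exists2 P : set 'rV[R]_d, cs_polytope n P & faces P j #= `I_m].

(* The maximum of [face_numbers R d n j]; the value is the junk value 0 if
   there is no maximum, in particular if [face_numbers R d n j] is empty. *)
Definition fmax (R : realType) (d n j : nat) : nat :=
  xget 0%N [set m | face_numbers R d n j m /\
                    forall m', face_numbers R d n j m' -> (m' <= m)%N].

(* Main.v *)
Require Import Defs.
From mathcomp Require Import zify ring lra.

(* Upper bound. Write P = conv(v_i) with the v_i its vertices; a proper face is
   given by a functional a with a(v_i) <= 1, through the set A of indices where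
   equality holds. Perturb the right-hand sides to c_i = 1 + t eps_i with eps
   generic and t small and generic: the perturbed polar polytope is simple, and A
   yields one of its vertices, whose tight set B is a basis of R^2k, such that
   A \cap B spans the span of A; so A is determined by B and A \cap B. Following
   Seidel, expand a fixed generic z in such a basis B: k of the 2k coordinates
   have the same sign, and linear programming shows that this sign and the other
   k indices determine B. Hence there are at most 2 C(n, k) bases and
   2^(2k+1) C(n, k) faces of any given dimension.

   Lower bound. The direct sum of k centrally symmetric polygons of about n / k
   vertices has about (n / k)^k faces of each dimension k <= j < 2k, namely joins
   of one edge or vertex of each polygon. The number n of vertices of a centrally
   symmetric polytope is even, so such a sum exists for all relevant large n. *)

Set Implicit Arguments.
Unset Strict Implicit.
Unset Printing Implicit Defensive.

Local Open Scope card_scope.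
Local Open Scope classical_set_scope.
Local Open Scope ring_scope.

(** * Functionals, spanning families and generic parameters *)

Section Dot.
Context {R : realType} {d : nat}.
Implicit Types (x y : 'rV[R]_d) (a b : 'cV[R]_d).

Definition dot x a : R := (x *m a) 0 0.

Lemma dotDl x y a : dot (x + y) a = dot x a + dot y a.
Proof. by rewrite /dot mulmxDl mxE. Qed.

Lemma dotDr x a b : dot x (a + b) = dot x a + dot x b.
Proof. by rewrite /dot mulmxDr mxE. Qed.

Lemma dotZl c x a : dot (c *: x) a = c * dot x a.
Proof. by rewrite /dot -scalemxAl mxE. Qed.

Lemma dotZr c x a : dot x (c *: a) = c * dot x a.
Proof. by rewrite /dot -scalemxAr mxE. Qed.

Lemma dotNl x a : dot (- x) a = - dot x a.
Proof. by rewrite /dot mulNmx mxE. Qed.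

Lemma dotNr x a : dot x (- a) = - dot x a.
Proof. by rewrite /dot mulmxN mxE. Qed.

Lemma dot0l a : dot 0 a = 0.
Proof. by rewrite /dot mul0mx mxE. Qed.

Lemma dot0r x : dot x 0 = 0.
Proof. by rewrite /dot mulmx0 mxE. Qed.

Lemma dot_suml (I : Type) (r : seq I) (P : pred I) (F : I -> 'rV[R]_d) a :
  dot (\sum_(i <- r | P i) F i) a = \sum_(i <- r | P i) dot (F i) a.
Proof. by rewrite /dot mulmx_suml summxE. Qed.

Lemma dot_sumZl (I : Type) (r : seq I) (P : pred I) (c : I -> R)
    (F : I -> 'rV[R]_d) a :
  dot (\sum_(i <- r | P i) c i *: F i) a =
  \sum_(i <- r | P i) c i * dot (F i) a.
Proof. by rewrite dot_suml; apply: eq_bigr => i _; rewrite dotZl. Qed.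

Lemma dot_eq0 a : (forall x, dot x a = 0) -> a = 0.
Proof.
move=> h; apply/matrixP => i j; rewrite ord1 mxE.
by have := h (delta_mx 0 i); rewrite /dot -rowE mxE.
Qed.

End Dot.

Section Spanning.
Context {R : realType} {d : nat} {I : finType}.
Implicit Types (v : I -> 'rV[R]_d) (B C : {set I}) (u : 'cV[R]_d).

Definition rows v B : 'M[R]_(#|B|, d) := \matrix_(x < #|B|) v (enum_val x).

Lemma mul_rows v B (u : 'rV[R]_#|B|) :
  u *m rows v B = \sum_x u 0 x *: v (enum_val x).
Proof.
rewrite mulmx_sum_row; apply: eq_bigr => x _; congr (_ *: _).
by apply/rowP => y; rewrite !mxE.
Qed.

Lemma rows_mul0 v B u :
  (forall i, i \in B -> dot (v i) u = 0) <-> rows v B *m u = 0.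
Proof.
have E x : (rows v B *m u) x 0 = dot (v (enum_val x)) u.
  by rewrite /dot !mxE; apply: eq_bigr => y _; rewrite !mxE.
split=> [h|h i iB].
  by apply/colP => x; rewrite E mxE h ?enum_valP.
by have := E (enum_rank_in iB i); rewrite h mxE enum_rankK_in.
Qed.

(** Dual form of spanning: no nonzero functional vanishes on the family. Walks between tight sets
    deliver it in this form. *)
Definition total v B :=
  forall u, (forall i, i \in B -> dot (v i) u = 0) -> u = 0.

Lemma total_row_full v B : total v B -> row_full (rows v B).
Proof.
move=> tB; apply/row_fullP/row_fullP; rewrite -cokermx_eq0.
apply/eqP/matrixP => i j; rewrite !mxE.
have h : col j (cokermx (rows v B)) = 0.
  by apply: tB; apply/rows_mul0; rewrite colE mulmxA mulmx_coker mul0mx.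
by move/colP: h => /(_ i); rewrite !mxE.
Qed.

Lemma total_span v B x : total v B ->
  exists lam : I -> R, x = \sum_(i in B) lam i *: v i.
Proof.
move=> /total_row_full /row_fullP[D DE].
pose y := x *m D.
exists (fun i => \sum_(s < #|B| | enum_val s == i) y 0 s).
have -> : x = y *m rows v B by rewrite /y -mulmxA DE mulmx1.
rewrite mul_rows [RHS]big_enum_val; apply: eq_bigr => s _; congr (_ *: _).
rewrite (big_pred1 s) // => t; exact: (inj_eq enum_val_inj).
Qed.

Lemma total_card v B : total v B -> (d <= #|B|)%N.
Proof. by move=> /total_row_full /eqP <-; exact: rank_leq_row. Qed.

Lemma exists_dependency v C : (d < #|C|)%N ->
  exists mu : I -> R, [/\ exists i, mu i != 0, forall i, i \notin C -> mu i = 0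
    & \sum_(i in C) mu i *: v i = 0].
Proof.
move=> dC; pose K := kermx (rows v C).
have K0 : K != 0.
  rewrite kermx_eq0; apply/negP => /eqP h.
  by have := rank_leq_col (rows v C); rewrite h leqNgt dC.
have [i [s Kis]] : exists i s, K i s != 0.
  apply: contrapT => h; move/eqP: K0; apply; apply/matrixP => i j.
  rewrite [RHS]mxE; apply: contrapT => /eqP ij.
  by apply: h; exists i, j.
have key s' : \sum_(t < #|C| | enum_val t == enum_val s') K i t = K i s'.
  by rewrite (big_pred1 s') // => t; exact: (inj_eq enum_val_inj).
exists (fun l => \sum_(t < #|C| | enum_val t == l) K i t); split.
- by exists (enum_val s); rewrite key.
- move=> l lC; rewrite big1 // => t /eqP tl; move: lC.
  by rewrite -tl enum_valP.
- rewrite [LHS]big_enum_val.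
  transitivity (row i K *m rows v C); last by rewrite -row_mul mulmx_ker row0.
  by rewrite mul_rows; apply: eq_bigr => t _; rewrite key !mxE.
Qed.

Lemma exists_annihilator v C : (#|C| < d)%N ->
  exists2 u : 'cV[R]_d, u != 0 & forall i, i \in C -> dot (v i) u = 0.
Proof.
move=> Cd; apply: contrapT => h.
have : total v C.
  move=> u uC; apply: contrapT => u0; apply: h; exists u => //; exact/eqP.
by move/total_card; rewrite leqNgt Cd.
Qed.

End Spanning.

Section Generic.
Context {R : realType}.

(** The product [q] of all [p x] has fewer roots than the [size q] sample points [t0 / i.+2], which
    all lie below [t0]. *)
Lemma exists_generic (J : finType) (p : J -> {poly R}) (t0 : R) : 0 < t0 ->
  (forall x, p x != 0) -> exists2 t, 0 < t < t0 & forall x, (p x).[t] != 0.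
Proof.
move=> t00 p0; pose q := \prod_x p x.
have q0 : q != 0 by apply/prodf_neq0 => x _.
pose rs := [seq t0 / (i.+2)%:R | i <- iota 0 (size q)].
have rsU : uniq rs.
  rewrite map_inj_uniq ?iota_uniq // => i i' /(mulfI (lt0r_neq0 t00)).
  by move/invr_inj/eqP; rewrite eqr_nat => /eqP [].
have /allPn[t] : ~~ all (root q) rs.
  apply/negP => h; have := max_poly_roots q0 h rsU.
  by rewrite size_map size_iota ltnn.
case/mapP => i _ -> rt; exists (t0 / i.+2%:R).
  by rewrite divr_gt0 ?ltr0n //= ltr_pdivrMr ?ltr0n // ltr_pMr // ltr1n.
move=> x; apply: contra rt => /eqP px.
by rewrite rootE /q horner_prod (bigD1 x) //= px mul0r.
Qed.

Lemma exists_small (J : finType) (M del : J -> R) : (forall x, 0 < del x) ->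
  exists2 t0, 0 < t0 & forall t x, 0 < t < t0 -> t * M x <= del x.
Proof.
move=> del0; pose S := \sum_x `|M x| / del x.
have S0 : 0 <= S by apply: sumr_ge0 => x _; rewrite divr_ge0 // ltW.
exists (1 + S)^-1; first by rewrite invr_gt0 ltr_pwDl.
move=> t x /andP[t0 tS].
have MS : `|M x| / del x <= S.
  by rewrite /S (bigD1 x) //= lerDl sumr_ge0 // => y _; rewrite divr_ge0 // ltW.
have tS1 : t * S <= 1.
  have : t * (1 + S) <= 1 by rewrite -ler_pdivlMr ?ltr_pwDl // mul1r ltW.
  by rewrite mulrDr mulr1; lra.
apply: (@le_trans _ _ (t * `|M x|)); first by rewrite ler_pM2l ?ler_norm.
have -> : t * `|M x| = (t * (`|M x| / del x)) * del x.
  by rewrite mulrA divfK // gt_eqF.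
rewrite ger_pMl //; apply: le_trans tS1; by rewrite ler_pM2l.
Qed.

End Generic.

(** * Moving to larger tight sets in a polyhedron *)

Section Walk.
Context {R : realType} {d : nat} {I : finType}.
Variables (v : I -> 'rV[R]_d) (D : {set I}) (c : I -> R).

Definition feasible (a : 'cV[R]_d) := forall i, i \in D -> dot (v i) a <= c i.

Definition tight (a : 'cV[R]_d) : {set I} := [set i in D | dot (v i) a == c i].

(** The ratio test of the simplex method: [u] keeps tight constraints tight, and the walk along [u]
    stops at the first constraint [i1] that blocks it. *)
Lemma tight_step a u i0 : feasible a ->
  (forall i, i \in tight a -> dot (v i) u = 0) -> i0 \in D ->
  0 < dot (v i0) u -> exists2 a', feasible a' & tight a \proper tight a'.
Proof.
move=> fa ua i0D ui0.
pose r i := (c i - dot (v i) a) / dot (v i) u.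
pose i1 := [arg min_(i < i0 | (i \in D) && (0 < dot (v i) u)) r i]%O.
have [i1D ui1 min1] : [/\ i1 \in D, 0 < dot (v i1) u & forall i, i \in D ->
    0 < dot (v i) u -> r i1 <= r i].
  rewrite /i1; case: arg_minP => [|i /andP[iD ui] mi]; first by rewrite i0D.
  by split=> // l lD ul; apply: mi; rewrite lD.
have r0 : 0 <= r i1 by rewrite divr_ge0 ?subr_ge0 ?fa // ltW.
exists (a + r i1 *: u).
  move=> i iD; rewrite dotDr dotZr.
  case: (ltP 0 (dot (v i) u)) => [ui|ui].
    by rewrite -lerBrDl -ler_pdivlMr //; exact: min1.
  by apply: le_trans (fa i iD); rewrite gerDl mulr_ge0_le0.
apply/properP; split.
  apply/fintype.subsetP => i it; have := it; rewrite !inE => /andP[-> /eqP ai].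
  by rewrite dotDr dotZr (ua i it) mulr0 addr0 ai eqxx.
exists i1.
  by rewrite inE i1D dotDr dotZr /r divfK ?subrKC ?eqxx // gt_eqF.
by apply/negP => /ua h; rewrite h ltxx in ui1.
Qed.

(** While some direction kills the tight vectors but not all of [D], [tight_step] along it or its
    opposite enlarges the tight set. At the end the tight vectors span those of [D]. *)
Lemma exists_tight_total a : feasible a -> exists a', [/\ feasible a',
  tight a \subset tight a' & forall u, (forall i, i \in tight a' ->
    dot (v i) u = 0) -> forall i, i \in D -> dot (v i) u = 0].
Proof.
have [m] := ubnP (#|I| - #|tight a|); elim: m a => // m IH a am fa.
case: (pselect (exists u i, [/\ forall i, i \in tight a -> dot (v i) u = 0,
  i \in D & dot (v i) u != 0])) => [[u [i [ua iD ui]]]|h]; last first.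
  exists a; split=> // u ua i iD; apply: contrapT => /eqP ui.
  by apply: h; exists u, i.
have [a' fa' aa'] : exists2 a', feasible a' & tight a \proper tight a'.
  case: (ltP 0 (dot (v i) u)) => ui0; first exact: (tight_step fa ua iD ui0).
  apply: (@tight_step a (- u) i) => // [l la|]; first by rewrite dotNr ua ?oppr0.
  by rewrite dotNr oppr_gt0 lt_neqAle ui.
have [||a'' [f'' s'' t'']] := IH a' => //.
  move: (proper_card aa') (max_card (mem (tight a'))) am.
  by move: #|tight a| #|tight a'| #|I| => x y z; lia.
exists a''; split=> //; exact: fintype.subset_trans (proper_sub aa') s''.
Qed.

End Walk.

(** * Counting bases and tight sets *)

(** On the moment curve a nonzero linear form becomes a nonzero polynomial, so generic points of the
    curve avoid finitely many given hyperplanes. *)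
Lemma exists_moment_poly (R : realType) (J : finType) (f : J -> R) i :
  f i != 0 -> exists2 p : {poly R}, p != 0 &
    forall t, p.[t] = \sum_j f j * t ^+ (enum_rank j).
Proof.
move=> fi; exists (\sum_j f j *: 'X^(enum_rank j)).
  apply: contra fi => /eqP/(congr1 (fun p : {poly R} => p`_(enum_rank i))).
  rewrite coef0 coef_sum (bigD1 i) //= big1 => [|j ji].
    by rewrite coefZ coefXn eqxx mulr1 addr0 => ->.
  rewrite coefZ coefXn eqn_leq -eqn_leq (inj_eq val_inj) (inj_eq enum_rank_inj).
  by rewrite eq_sym (negbTE ji) mulr0.
by move=> t; rewrite horner_sum; apply: eq_bigr => j _; rewrite hornerZ hornerXn.
Qed.

Lemma exists_subset_card (T : finType) (B : {set T}) m : (m <= #|B|)%N ->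
  exists2 Q : {set T}, Q \subset B & #|Q| = m.
Proof.
rewrite -bin_gt0 -cards_draws => /card_gt0P[Q].
by rewrite inE => /andP[QB /eqP Qm]; exists Q.
Qed.

Section BasisBound.
Context {R : realType} {I : finType} {d : nat}.
Variables (v : I -> 'rV[R]_d) (c : I -> R).

(** The vertices of the polyhedron cut out by [dot (v i) a <= c i], each recorded by its tight
    set. *)
Definition bases : {set {set I}} := [set B | `[< exists a,
  [/\ feasible v [set: I] c a, B = tight v [set: I] c a & total v B] >]].

(** Such a [z] lies in no span of fewer than [d] of the vectors. *)
Lemma exists_generic_row : exists z : 'rV[R]_d, forall C : {set I},
  (#|C| < d)%N -> exists2 u, (forall i, i \in C -> dot (v i) u = 0) & dot z u != 0.
Proof.
have /choice[p pP] (C : {set I}) : exists p : {poly R}, p != 0 /\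
    ((#|C| < d)%N -> exists2 u, (forall i, i \in C -> dot (v i) u = 0) &
      forall t, p.[t] = dot (\row_j t ^+ (enum_rank j)) u).
  case: (ltnP #|C| d) => [Cd|_]; last by exists 1; rewrite oner_eq0.
  have [u u0 uC] := exists_annihilator v Cd.
  have [i ui] : exists i, u i 0 != 0.
    apply: contrapT => h; move/eqP: u0; apply; apply/colP => i.
    by rewrite [RHS]mxE; apply: contrapT => /eqP ui; apply: h; exists i.
  have [p p0 pt] := @exists_moment_poly R _ (fun j => u j 0) i ui.
  exists p; split=> // _; exists u => // t.
  by rewrite pt /dot mxE; apply: eq_bigr => j _; rewrite mxE mulrC.
have [t _ pt] := exists_generic ltr01 (fun C => (pP C).1).
exists (\row_j t ^+ (enum_rank j)) => C /(pP C).2[u uC up].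
by exists u => //; rewrite -up.
Qed.

End BasisBound.

Section BasisCount.
Context {R : realType} {I : finType} {k : nat}.
Variables (v : I -> 'rV[R]_(k + k)) (c : I -> R).

(** Simplicity of the polyhedron: no point has more than [2k] tight constraints. *)
Hypothesis c_generic : forall (C : {set I}) a, (k + k < #|C|)%N ->
  ~ (forall i, i \in C -> dot (v i) a = c i).

(** A code is a sign and a set of [k] indices of [B]; at the other indices of [B] all coordinates of
    [z] have that sign. *)
Let coded (z : 'rV[R]_(k + k)) (B : {set I}) (y : bool * {set I}) :=
  [/\ y.2 \subset B, #|y.2| = k & exists2 lam : I -> R,
    z = \sum_(i in B) lam i *: v i &
    forall i, i \in B -> i \notin y.2 -> 0 < (-1) ^+ y.1 * lam i].

Let exists_code z B : (forall C : {set I}, (#|C| < k + k)%N ->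
    exists2 u, (forall i, i \in C -> dot (v i) u = 0) & dot z u != 0) ->
  B \in bases v c -> exists y, coded z B y.
Proof.
move=> zP; rewrite inE => /asboolP[a [fa Ba tB]].
have Bd : #|B| = (k + k)%N.
  apply/eqP; rewrite eqn_leq (total_card tB) andbT leqNgt; apply/negP => h.
  apply: (c_generic (a := a) h) => i; rewrite Ba inE => /andP[_ /eqP //].
have [lam zE] := total_span z tB.
have lam0 i : i \in B -> lam i != 0.
  move=> iB; apply/eqP => li.
  (* A zero coordinate would put [z] in the span of [2k - 1] vectors. *)
  have [|u uC /eqP] := zP (B :\ i).
    by have := cardsD1 i B; rewrite iB Bd; lia.
  apply; rewrite zE dot_sumZl big1 // => l lB.
  have [->|li'] := eqVneq l i; first by rewrite li mul0r.
  by rewrite uC ?mulr0 // !inE li'.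
pose P (s : bool) := [set i in B | 0 < (-1) ^+ s * lam i].
have PB s : P s \subset B by apply/fintype.subsetP => i; rewrite inE => /andP[].
have [s ks] : exists s, (k <= #|P s|)%N.
  case: (leqP k #|P false|) => h0; first by exists false.
  case: (leqP k #|P true|) => h1; first by exists true.
  have : B \subset P false :|: P true.
    apply/fintype.subsetP => i iB; rewrite !inE iB /= expr0 expr1 mul1r mulN1r.
    by rewrite oppr_gt0 -neq_lt eq_sym lam0.
  move/subset_leq_card; rewrite Bd => /leq_trans/(_ (leq_card_setU _ _).1).
  by rewrite leqNgt -addnS leq_add // ltnW.
have [Q QP Qk] := exists_subset_card ks.
have QB := fintype.subset_trans QP (PB s).
exists (s, B :\: Q); split => /=; first exact: subsetDl.
  by rewrite cardsD (finset.setIidPr QB) Bd Qk addnK.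
exists lam => // i iB; rewrite inE iB andbT negbK => /(fintype.subsetP QP).
by rewrite inE => /andP[].
Qed.

(* An LP certificate: among the feasible [a'] that are tight on [y.2], the
   vertex with tight set [B] maximizes the functional [(-1) ^+ y.1 * z], and
   it is the only maximizer. *)
Let code_max z B a a' y : coded z B y ->
  (forall i, i \in B -> dot (v i) a = c i) -> feasible v [set: I] c a' ->
  (forall i, i \in y.2 -> dot (v i) a' = c i) ->
  (-1) ^+ y.1 * dot z a' <= (-1) ^+ y.1 * dot z a ?= iff
    (B \subset tight v [set: I] c a').
Proof.
move=> [yB _ [lam -> lam0]] aB fa' a'y.
rewrite !dot_sumZl !mulr_sumr.
have -> : (B \subset tight v [set: I] c a') =
    [forall (i | i \in B), dot (v i) a' == c i].
  apply/fintype.subsetP/forall_inP => h i /h; by rewrite !inE.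
apply: leif_sum => i iB; rewrite !mulrA (aB i iB).
case: (boolP (i \in y.2)) => iy; first by rewrite a'y // eqxx; exact/leif_refl.
have l0 := lam0 i iB iy; split; first by rewrite ler_pM2l // fa' ?inE.
by rewrite (inj_eq (mulfI (lt0r_neq0 l0))).
Qed.

(** Two bases with the same code belong to feasible points that are both tight on the coded set, so
    each maximizes the same functional against the other. Equality in [code_max] then gives
    [B = B']. *)
Lemma card_bases : (#|bases v c| <= 2 * 'C(#|I|, k))%N.
Proof.
have [z zP] := exists_generic_row v.
have /choice[f fP] (B : {set I}) : exists y, B \in bases v c -> coded z B y.
  case: (boolP (B \in bases v c)) => [/(exists_code zP)[y]|_]; first by exists y.
  by exists (true, finset.set0).
have sub B B' : B \in bases v c -> B' \in bases v c -> f B = f B' -> B = B'.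
  move=> hB hB' ff; have cB := fP B hB; have cB' := fP B' hB'.
  move: hB; rewrite inE => /asboolP[a [fa Ba _]].
  move: hB'; rewrite inE => /asboolP[a' [fa' Ba' _]].
  have tB i : i \in B -> dot (v i) a = c i.
    by rewrite Ba inE => /andP[_ /eqP].
  have tB' i : i \in B' -> dot (v i) a' = c i.
    by rewrite Ba' inE => /andP[_ /eqP].
  have [yB _ _] := cB; have [yB' _ _] := cB'.
  have l1 := code_max cB tB fa' _.
  have l2 := code_max cB' tB' fa _.
  rewrite -!ff in l2 yB'.
  have {}l1 := l1 (fun i iy => tB' i (fintype.subsetP yB' i iy)).
  have {}l2 := l2 (fun i iy => tB i (fintype.subsetP yB i iy)).
  have e := le_anti (introT andP (conj l1.1 l2.1)).
  apply/eqP; rewrite finset.eqEsubset {1}Ba' {2}Ba -l1.2 -l2.2 e.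
  by rewrite !eqxx.
rewrite -(card_in_imset sub).
apply: (@leq_trans #|finset.setX [set: bool]%SET [set S : {set I} | #|S| == k]%SET|).
  apply/subset_leq_card/fintype.subsetP => y /imsetP[B hB ->].
  case: (f B) (fP B hB) => s S [/= _ h _].
  by rewrite finset.in_setX finset.in_setT finset.in_set h eqxx.
by rewrite cardsX cardsT card_bool card_draws.
Qed.

End BasisCount.

(** * Perturbation and the number of tight sets *)

Section TightSets.
Context {R : realType} {I : finType} {k : nat}.
Variable v : I -> 'rV[R]_(k + k).
Local Notation d := (k + k)%N.

(** Supporting functionals are normalized to level 1. For proper nonempty faces of a
    full-dimensional centrally symmetric polytope this is no restriction. *)
Definition tight_sets : {set {set I}} := [set A : {set I} | `[< exists2 a,
  (forall i, dot (v i) a <= 1) & A = [set i | dot (v i) a == 1]%SET >]].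

Lemma card_tight_sets : total v [set: I] ->
  (#|tight_sets| <= 2 * 'C(#|I|, k) * 2 ^ (k + k))%N.
Proof.
move=> tv.
have /choice[mu muP] (C : {set I}) : exists mu : I -> R, (d < #|C|)%N ->
    [/\ exists i, mu i != 0, forall i, i \notin C -> mu i = 0
      & \sum_(i in C) mu i *: v i = 0].
  case: (ltnP d #|C|) => [/(exists_dependency v)[m]|_]; first by exists m.
  by exists (fun=> 0).
(* A generic point of the moment curve is annihilated by none of the chosen dependencies.
   Nonnegativity makes 0 a feasible start of the walk that defines [b]. *)
have [eps eps0 epsP] : exists2 eps : I -> R, (forall i, 0 <= eps i) &
    forall C : {set I}, (d < #|C|)%N -> \sum_(i in C) mu C i * eps i != 0.
  have /choice[p pP] (C : {set I}) : exists p : {poly R}, p != 0 /\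
      ((d < #|C|)%N -> forall t, p.[t] = \sum_i mu C i * t ^+ (enum_rank i)).
    case: (ltnP d #|C|) => [Cd|_]; last by exists 1; rewrite oner_eq0.
    have [[i mi] _ _] := muP C Cd.
    by have [p p0 pt] := exists_moment_poly mi; exists p.
  have [t /andP[t0 _] tP] := exists_generic ltr01 (fun C => (pP C).1).
  exists (fun i => t ^+ (enum_rank i)) => [i|C Cd]; first exact/exprn_ge0/ltW.
  have := tP C; rewrite (pP C).2 // (bigID (mem C)) /=.
  rewrite [X in _ + X]big1 ?addr0 // => i iC.
  by have [_ -> //] := muP C Cd; rewrite mul0r.
(* [w A] is a pair [(a, b)]: [a] exposes [A], and moving to [a + t *: b] stays
   feasible for small [t] and keeps tight a subset of [A] with the same span. *)
have /choice[w wP] (A : {set I}) : exists w : 'cV[R]_d * 'cV[R]_d,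
    A \in tight_sets -> [/\ forall i, dot (v i) w.1 <= 1,
      A = [set i | dot (v i) w.1 == 1]%SET,
      feasible v A eps w.2 & forall u, (forall i, i \in tight v A eps w.2 ->
        dot (v i) u = 0) -> forall i, i \in A -> dot (v i) u = 0].
  case: (boolP (A \in tight_sets)) => [|_]; last by exists (0, 0).
  rewrite inE => /asboolP[a a1 Aa].
  have [|b [fb _ tb]] := @exists_tight_total R d I v A eps 0.
    by move=> i _; rewrite dot0r.
  by exists (a, b).
(* The slack that the move by [t] must not exhaust on constraints outside [A]; the value 1 elsewhere
   only keeps [del] positive. *)
pose del (x : {set I} * I) :=
  if (x.1 \in tight_sets) && (x.2 \notin x.1) then 1 - dot (v x.2) (w x.1).1
  else 1.
pose M (x : {set I} * I) := dot (v x.2) (w x.1).2 - eps x.2.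
have del0 x : 0 < del x.
  rewrite /del; case: ifP => // /andP[xA xn]; have [h1 h2 _ _] := wP _ xA.
  by rewrite subr_gt0 lt_neqAle h1 andbT; move: xn; rewrite {1}h2 inE.
have [t0 t00 t0P] := exists_small M del0.
(* If more than [2k] perturbed constraints were tight at [a], pairing their dependency with [a]
   would make [t] a root of [p C], which is nonzero by [epsP]. *)
have [t tt0 ct] : exists2 t, 0 < t < t0 & forall (C : {set I}) a,
    (d < #|C|)%N -> ~ (forall i, i \in C -> dot (v i) a = 1 + t * eps i).
  pose p (C : {set I}) : {poly R} := if (d < #|C|)%N then
    (\sum_(i in C) mu C i)%:P + (\sum_(i in C) mu C i * eps i)%:P * 'X else 1.
  have p0 C : p C != 0.
    rewrite /p; case: ifP => Cd; last exact: oner_neq0.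
    apply: contra (epsP C Cd) => /eqP/(congr1 (fun q : {poly R} => q`_1)).
    by rewrite coef0 coefD coefMX !coefC /= add0r => ->.
  have [t tt0 pt] := exists_generic t00 p0.
  exists t => // C a Cd h; have := pt C; rewrite /p Cd !hornerE => /eqP; apply.
  have [_ _ /(congr1 (fun x => dot x a))] := muP C Cd.
  rewrite dot_sumZl dot0l => s0; rewrite -[RHS]s0 mulr_suml -big_split /=.
  by apply: eq_bigr => i iC; rewrite h // mulrDr mulr1 [t * _]mulrC mulrA.
pose c i := 1 + t * eps i.
have /andP[t_gt0 _] := tt0.
(* The moved functional is feasible for [c]; walking on from it reaches a vertex, whose tight set is
   [g A]. *)
have /choice[g gP] (A : {set I}) : exists B, A \in tight_sets ->
    B \in bases v c /\ tight v A eps (w A).2 \subset B.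
  case: (boolP (A \in tight_sets)) => [hA|_]; last by exists A.
  have [h1 h2 h3 h4] := wP A hA.
  pose a := (w A).1 + t *: (w A).2.
  have fa : feasible v [set: I] c a.
    move=> i _; rewrite /a dotDr dotZr /c; case: (boolP (i \in A)) => iA.
      have := iA; rewrite {1}h2 inE => /eqP ->.
      by rewrite lerD2l ler_pM2l // h3.
    have := t0P t (A, i) tt0; rewrite /del /M /= hA iA /= mulrBr; lra.
  have [a' [fa' aa' ta']] := exists_tight_total fa.
  exists (tight v [set: I] c a') => _; split.
    rewrite inE; apply/asboolP; exists a'; split=> // u ua'.
    by apply: tv => i _; apply: ta'.
  apply: fintype.subset_trans aa'; apply/fintype.subsetP => i.
  rewrite !inE /= => /andP[iA /eqP bi]; rewrite /a dotDr dotZr bi /c.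
  by move: iA; rewrite {1}h2 inE => /eqP ->.
rewrite -sum1_card (partition_big g (mem (bases v c))) => [|A /gP[] //] /=.
apply: (@leq_trans (\sum_(B in bases v c) 2 ^ d)%N); last first.
  by rewrite sum_nat_const leq_mul2r card_bases ?orbT.
apply: leq_sum => B hB.
have Bd : (#|B| <= d)%N.
  move: hB; rewrite inE => /asboolP[a [_ Ba _]]; rewrite leqNgt; apply/negP => h.
  by apply: (ct B a h) => i; rewrite Ba inE => /andP[_ /eqP].
apply: (@leq_trans #|powerset B|); last by rewrite card_powerset leq_pexp2l.
rewrite sum1_card.
(* The functionals of [A] and [A'] both equal 1 on [A :&: B], which spans [A], so they agree on all
   of [A]. *)
have sub (A A' : {set I}) : A \in tight_sets -> A' \in tight_sets -> g A = B ->
    A :&: B = A' :&: B -> A \subset A'.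
  move=> hA hA' gA AA'; have [_ h2 _ h4] := wP A hA.
  have [_ h2' _ _] := wP A' hA'; have [_ sB] := gP A hA.
  have mA l : (l \in A) = (dot (v l) (w A).1 == 1) by rewrite {1}h2 inE.
  have mA' l : (l \in A') = (dot (v l) (w A').1 == 1) by rewrite {1}h2' inE.
  apply/fintype.subsetP => i iA; have := iA; rewrite mA mA' => /eqP <-.
  rewrite -subr_eq0 -dotNr -dotDr; apply/eqP; apply: h4 iA => l lt.
  have lA : l \in A by move: lt; rewrite inE => /andP[].
  have : l \in A' :&: B by rewrite -AA' inE lA -gA (fintype.subsetP sB).
  rewrite inE mA' => /andP[/eqP l1 _]; move: lA; rewrite mA => /eqP l2.
  by rewrite dotDr dotNr l1 l2 subrr.
rewrite -(@card_in_imset _ _ (fun A : {set I} => A :&: B)).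
  apply/subset_leq_card/fintype.subsetP => X /imsetP[A _ ->].
  by rewrite powersetE subsetIr.
move=> A A' /andP[hA /eqP gA] /andP[hA' /eqP gA'] AA'.
by apply/eqP; rewrite finset.eqEsubset !sub.
Qed.

End TightSets.

(** * Convex hulls and exposed points *)

Section Counting.

Lemma card_eq_ordP (T : Type) (X : set T) m : X #= `I_m ->
  exists2 g : 'I_m -> T, injective g & range g = X.
Proof.
rewrite card_eq_sym => /card_bijP[f fb].
have memI (i : 'I_m) : (i : nat) \in `I_m by rewrite in_setE /=.
exists (fun i => val (f (SigSub (memI i)))).
  move=> i i' /val_inj/(bij_inj fb)/(congr1 val) /= e; exact: val_inj.
apply/seteqP; split => [x [i _ <-]|x Xx].
  by have := valP (f (SigSub (memI i))); rewrite in_setE.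
have [h _ fK] := fb; have xX : x \in X by rewrite in_setE.
have := valP (h (SigSub xX)); rewrite in_setE /= => hm.
exists (Ordinal hm) => //.
have -> : SigSub (memI (Ordinal hm)) = h (SigSub xX) by exact: val_inj.
by rewrite fK.
Qed.

Lemma card_range (T : Type) (J : finType) (g : J -> T) : injective g ->
  range g #= `I_#|J|.
Proof.
move=> gI; apply: card_eq_trans (_ : [set: J] #= _).
  by apply: inj_card_eq => i i' _ _ /gI.
have -> : `I_#|J| = range (fun x : J => enum_rank x : nat).
  apply/seteqP; split => [i /= im|_ [x _ <-] /=]; last exact: ltn_ord.
  by exists (enum_val (Ordinal im)) => //; rewrite enum_valK.
rewrite card_eq_sym; apply: inj_card_eq => i i' _ _ /val_inj; exact: enum_rank_inj.
Qed.

Lemma card_le_finType (T : Type) (J : finType) (D : {set J}) (X : set T) m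
    (h : T -> J) : X #= `I_m -> {in X &, injective h} ->
  (forall x, X x -> h x \in D) -> (m <= #|D|)%N.
Proof.
move=> /card_eq_ordP[g gI gX] hI hD; rewrite -[m]card_ord.
have Xg i : X (g i) by rewrite -gX; exists i.
rewrite -(card_codom (f := h \o g)).
  by apply/subset_leq_card/fintype.subsetP => _ /codomP[i ->]; exact: hD.
by move=> i i' e; apply: gI; apply: hI e; rewrite in_setE.
Qed.

Lemma card_ge_finType (T : Type) (J : finType) (X : set T) m (h : J -> T) :
  X #= `I_m -> injective h -> (forall x, X (h x)) -> (#|J| <= m)%N.
Proof.
move=> /card_eq_ordP[g gI gX] hI hX; rewrite -[m]card_ord.
have /choice[f fP] x : exists i, g i = h x.
  by have := hX x; rewrite -gX => -[i _ <-]; exists i.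
by apply: (@leq_card _ _ f) => x x' e; apply: hI; rewrite -!fP e.
Qed.

(** The involution exchanges the indices with [i < s i] and the remaining ones. *)
Lemma fixfree_involution_even n (s : 'I_n -> 'I_n) :
  involutive s -> (forall i, s i != i) -> ~~ odd n.
Proof.
move=> sK s1; pose A := [set i : 'I_n | (i < s i)%N]%SET.
have AC : ~: A = s @: A.
  apply/setP => i; rewrite !inE -leqNgt; apply/idP/imsetP => [si|[l lA ->]].
    exists (s i); rewrite ?sK // inE sK ltn_neqAle si andbT.
    by apply: contra (s1 i) => /eqP/val_inj ->.
  by move: lA; rewrite inE sK => /ltnW.
have := cardsC A; rewrite AC card_imset ?card_ord; last exact: inv_inj.
by move=> <-; rewrite addnn odd_double.
Qed.

End Counting.

Section Hull.
Context {R : realType} {d : nat}.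

Lemma hull_imageP (I : finType) (v : I -> 'rV[R]_d) (S : set I) x :
  convex_hull (v @` S) x <-> exists a : I -> R,
    [/\ forall i, 0 <= a i, \sum_i a i = 1, x = \sum_i a i *: v i
      & forall i, a i != 0 -> S i].
Proof.
split=> [[m [b [p [pS b0 b1 ->]]]]|[a [a0 a1 -> aS]]].
  have /choice[f fP] s : exists i, S i /\ v i = p s.
    by have [i Si e] := pS s; exists i.
  exists (fun i => \sum_(s | f s == i) b s); split.
  - by move=> i; apply: sumr_ge0.
  - by rewrite -b1 (partition_big f predT).
  - rewrite (partition_big f predT) //=; apply: eq_bigr => i _.
    by rewrite scaler_suml; apply: eq_bigr => s /eqP <-; rewrite (fP s).2.
  - move=> i; apply: contraPP => Si; apply/negP; rewrite negbK big1 // => s /eqP e.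
    by case: Si; rewrite -e; case: (fP s).
(* [i0] is a filler: indices of coefficient 0 may lie outside [S] but still need a point from
   [S]. *)
have [i0 i0S] : exists i, S i.
  apply: contrapT => h; move: a1; rewrite big1 => [/eqP|i _].
    by rewrite eq_sym oner_eq0.
  by apply: contrapT => /eqP ai; apply: h; exists i; exact: aS.
exists #|I|, (a \o enum_val),
  (fun s => v (if a (enum_val s) == 0 then i0 else enum_val s)).
split=> [s|s||] /=.
- by case: eqP => [_|/eqP /aS]; [exists i0|exists (enum_val s)].
- exact: a0.
- rewrite -a1 (reindex (@enum_val I (mem I))) //=; exact/onW_bij/enum_val_bij.
- rewrite (reindex (@enum_val I (mem I))) /=; last exact/onW_bij/enum_val_bij.
  by apply: eq_bigr => s _; case: eqP => // ->; rewrite !scale0r.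
Qed.

Lemma hullP (I : finType) (v : I -> 'rV[R]_d) x :
  convex_hull (range v) x <-> exists a : I -> R,
    [/\ forall i, 0 <= a i, \sum_i a i = 1 & x = \sum_i a i *: v i].
Proof.
rewrite hull_imageP; split=> -[a []]; first by exists a.
by move=> a0 a1 xE; exists a.
Qed.

Lemma hull_vertex (I : finType) (v : I -> 'rV[R]_d) (S : set I) i : S i ->
  convex_hull (v @` S) (v i).
Proof.
move=> Si; apply/hull_imageP; exists (fun l => (l == i)%:R); split.
- by move=> l; rewrite ler0n.
- by rewrite (bigD1 i) //= eqxx big1 ?addr0 // => l /negbTE ->.
- rewrite (bigD1 i) //= eqxx scale1r big1 ?addr0 // => l /negbTE ->.
  by rewrite scale0r.
- by move=> l; case: (l =P i) => [->|_] //; rewrite eqxx.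
Qed.

Lemma hull_trans (I J : finType) (v : I -> 'rV[R]_d) (w : J -> 'rV[R]_d) :
  (forall i, convex_hull (range w) (v i)) ->
  convex_hull (range v) `<=` convex_hull (range w).
Proof.
move=> vw x /hullP[a [a0 a1 ->]].
have /choice[b bP] i := (hullP w (v i)).1 (vw i).
apply/hullP; exists (fun l => \sum_i a i * b i l); split.
- by move=> l; apply: sumr_ge0 => i _; rewrite mulr_ge0 //; case: (bP i).
- rewrite exchange_big /= -a1; apply: eq_bigr => i _.
  by rewrite -mulr_sumr; case: (bP i) => _ -> _; rewrite mulr1.
- under [RHS]eq_bigr do rewrite scaler_suml.
  rewrite exchange_big /=; apply: eq_bigr => i _.
  case: (bP i) => _ _ {1}->; rewrite scaler_sumr.
  by apply: eq_bigr => l _; rewrite scalerA.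
Qed.

Lemma hull_le (I : finType) (v : I -> 'rV[R]_d) (S : set I) a c :
  (forall i, S i -> dot (v i) a <= c) ->
  forall x, convex_hull (v @` S) x -> dot x a <= c.
Proof.
move=> vc x /hull_imageP[b [b0 b1 -> bS]]; rewrite dot_sumZl -[c]mul1r -b1.
rewrite mulr_suml; apply: ler_sum => i _.
by have [->|/bS/vc h] := eqVneq (b i) 0; rewrite ?mul0r // ler_wpM2l.
Qed.

(** Where [a] attains [c], the nonnegative terms [b l * (c - dot (v l) a)] sum to 0, so only
    generators on the hyperplane carry weight. *)
Lemma hull_face (I : finType) (v : I -> 'rV[R]_d) a c :
  (forall i, dot (v i) a <= c) ->
  convex_hull (range v) `&` [set x | dot x a = c] =
  convex_hull (v @` [set i | dot (v i) a = c]).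
Proof.
move=> vc; apply/seteqP; split=> x.
  move=> [/hullP[b [b0 b1 ->]] /=]; rewrite dot_sumZl => bc.
  apply/hull_imageP; exists b; split=> // i bi /=; apply/eqP.
  have : \sum_l b l * (c - dot (v l) a) = 0.
    under eq_bigr do rewrite mulrBr.
    by rewrite sumrB bc -mulr_suml b1 mul1r subrr.
  move=> /psumr_eq0P/(_ i isT) h; have := h _.
  rewrite eq_sym -subr_eq0 => /(_ _)/eqP; rewrite mulf_eq0 (negbTE bi); apply.
  by move=> l _; rewrite mulr_ge0 // subr_ge0.
move=> /hull_imageP[b [b0 b1 -> bS]]; split; first by apply/hullP; exists b.
rewrite /= dot_sumZl -[RHS]mul1r -b1 mulr_suml; apply: eq_bigr => i _.
by have [->|/bS -> //] := eqVneq (b i) 0; rewrite !mul0r.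
Qed.

End Hull.

(** * Farkas' lemma and separation *)

Section Farkas.
Context {R : realType}.

(* Eliminating the last generator [w] against a functional [y] that separates
   [b] from the others but is positive on [w]: everything is projected along
   [w] to the kernel of [y]. *)
Lemma farkas d n (v : 'I_n -> 'rV[R]_d) (b : 'rV[R]_d) :
  (forall lam : 'I_n -> R, (forall i, 0 <= lam i) -> b <> \sum_i lam i *: v i) ->
  exists2 y, (forall i, dot (v i) y <= 0) & 0 < dot b y.
Proof.
elim: n v b => [|n IH] v b nb.
  have b0 : b != 0.
    apply/eqP => b0; apply: (nb (fun=> 0)) => //.
    by rewrite big_ord0.
  have [i bi] : exists i, b 0 i != 0.
    apply: contrapT => h; move/eqP: b0; apply; apply/rowP => i.
    by rewrite [RHS]mxE; apply: contrapT => /eqP bi; apply: h; exists i.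
  exists (b 0 i *: delta_mx i 0) => [[]//|].
  by rewrite dotZr /dot -colE mxE -expr2 exprn_even_gt0.
pose u i := v (lift ord0 i); pose w := v ord0.
have {}nb mu (lam : 'I_n -> R) : 0 <= mu -> (forall i, 0 <= lam i) ->
    b <> mu *: w + \sum_i lam i *: u i.
  move=> mu0 lam0; have := nb (fun i => oapp lam mu (unlift ord0 i)) _.
  rewrite big_ord_recl unlift_none.
  under eq_bigr do rewrite liftK.
  apply=> i; case: unliftP => [j _|_] /=; [exact: lam0|exact: mu0].
have [|y uy yb] := IH u b.
  by move=> lam lam0 bE; apply: (nb 0 lam) => //; rewrite scale0r add0r.
case: (leP (dot w y) 0) => [yw|yw].
  by exists y => // i; case: (unliftP ord0 i) => [j|] ->; [exact: uy|].
have [|y' uy' yb'] := IH (fun i => dot w y *: u i - dot (u i) y *: w)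
    (dot w y *: b - dot b y *: w).
  move=> lam lam0 e; have w0 := lt0r_neq0 yw.
  (* The coefficient that a representation of the projected [b] forces on [w]. It is nonnegative
     because [y] is positive at [b] and at most 0 on the [u i]. *)
  apply: (nb ((dot w y)^-1 * (dot b y - \sum_i lam i * dot (u i) y)) lam) => //.
    rewrite mulr_ge0 ?invr_ge0 ?(ltW yw) // subr_ge0.
    apply: (@le_trans _ _ 0) (ltW yb); apply: sumr_le0 => i _.
    by rewrite mulr_ge0_le0 // uy.
  apply: (scalerI w0); move/eqP: e; rewrite subr_eq => /eqP ->.
  have -> : \sum_i lam i *: (dot w y *: u i - dot (u i) y *: w) =
      dot w y *: (\sum_i lam i *: u i) - (\sum_i lam i * dot (u i) y) *: w.
    rewrite scaler_sumr scaler_suml -sumrB; apply: eq_bigr => i _.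
    by rewrite scalerBr !scalerA [lam i * dot w y]mulrC.
  rewrite scalerDr [in RHS]scalerA mulVKf // scalerBl.
  by rewrite [LHS]addrC addrA [RHS]addrAC.
(* This is [y'] composed with the projection of [x] to [dot w y *: x - dot x y *: w], so it vanishes
   on [w]. *)
exists (dot w y *: y' - dot w y' *: y) => [i|].
  rewrite dotDr dotNr !dotZr; case: (unliftP ord0 i) => [j|] ->.
    by have := uy' j; rewrite dotDl dotNl !dotZl /u mulrC [X in _ - X]mulrC mulrC.
  by rewrite -/w mulrC subrr.
move: yb'; rewrite dotDl dotNl !dotZl dotDr dotNr !dotZr.
by rewrite [dot b y * _]mulrC.
Qed.

(** Appending a coordinate 1 turns convex combinations into conic ones, to which [farkas] applies;
    the last entry of its functional cancels in the comparison. *)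
Lemma separation d n (v : 'I_n -> 'rV[R]_d) (b : 'rV[R]_d) :
  ~ convex_hull (range v) b -> exists a, forall i, dot (v i) a < dot b a.
Proof.
move=> nb; pose h (x : 'rV[R]_d) : 'rV[R]_(d + 1) := row_mx x 1%:M.
have dh x a : dot (h x) a = dot x (usubmx a) + a (rshift d 0) 0.
  rewrite -{1}[a]vsubmxK /dot mul_row_col mxE mul1mx; congr (_ + _).
  by rewrite mxE.
have [|a ha hb] := @farkas (d + 1) n (h \o v) (h b).
  move=> lam lam0 /= e; apply: nb; apply/hullP; exists lam; split=> //.
    have := congr1 (fun x : 'rV[R]_(d + 1) => x 0 (rshift d 0)) e.
    rewrite summxE /h row_mxEr mxE eqxx => e1; apply: etrans (esym e1).
    apply: eq_bigr => i _.
    by rewrite mxE row_mxEr mxE mulr1.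
  have := congr1 lsubmx e; rewrite linear_sum /= /h row_mxKl => ->.
  by apply: eq_bigr => i _; rewrite linearZ /= row_mxKl.
exists (usubmx a) => i; have := ha i; rewrite /= dh; move: hb; rewrite dh; lra.
Qed.

End Farkas.

(** * Dimension, faces and vertices *)

Section Faces.
Context {R : realType} {d : nat}.

Lemma affine_hull_sub (A : set 'rV[R]_d) : A `<=` affine_hull A.
Proof.
move=> x Ax; exists 1%N, (fun=> 1), (fun=> x).
by rewrite !big_ord1 scale1r.
Qed.

Lemma hull_affine_hull (I : finType) (v : I -> 'rV[R]_d) (a : I -> R) :
  \sum_i a i = 1 -> affine_hull (convex_hull (range v)) (\sum_i a i *: v i).
Proof.
move=> a1; exists #|I|, (a \o enum_val), (v \o enum_val); split=> /=.
- by move=> s; exact: hull_vertex.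
- rewrite -a1 (reindex (@enum_val I (mem I))) //=; exact/onW_bij/enum_val_bij.
- rewrite (reindex (@enum_val I (mem I))) //=; exact/onW_bij/enum_val_bij.
Qed.

Lemma has_dim_full (A : set 'rV[R]_d) : has_dim A d <-> affine_hull A = setT.
Proof.
split=> [[p [U [Ud ->]]]|AT].
  have UT : U = fullv.
    by apply/eqP; rewrite eqEdim subvf Ud dimvf /dim /= mul1n.
  apply/seteqP; split=> // x _; exists (x - p); first by rewrite UT /= memvf.
  by rewrite addrC subrK.
exists 0, fullv; split; first by rewrite dimvf /dim /= mul1n.
rewrite AT; apply/seteqP; split=> // x _; exists x; rewrite ?add0r //=.
exact: memvf.
Qed.

Lemma has_dim_proper (A : set 'rV[R]_d) j : has_dim A d -> has_dim A j -> j = d.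
Proof.
move=> /has_dim_full AT [p [U [<- AU]]].
have -> : U = fullv.
  apply/vspaceP => u; rewrite memvf; have : affine_hull A (p + u) by rewrite AT.
  by rewrite AU => -[u' /= Uu' /addrI <-].
by rewrite dimvf /dim /= mul1n.
Qed.

Lemma has_dim_nonempty (A : set 'rV[R]_d) j : has_dim A j -> A !=set0.
Proof.
move=> [p [U [_ AU]]]; have : affine_hull A p.
  by rewrite AU; exists 0; rewrite ?addr0 //= mem0v.
case=> [[|m] [a [q [qA a1 _]]]]; last by exists (q ord0).
by move/eqP: a1; rewrite big_ord0 eq_sym oner_eq0.
Qed.

Lemma has_dim0 (A : set 'rV[R]_d) : has_dim A 0 <-> exists x, A = [set x].
Proof.
split=> [A0|[x ->]].
  have [x Ax] := has_dim_nonempty A0; exists x.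
  have [p [U [/eqP U0 AU]]] := A0.
  have Ap y : A y -> y = p.
    move/affine_hull_sub; rewrite AU => -[u /=].
    by move: U0; rewrite dimv_eq0 => /eqP ->; rewrite memv0 => /eqP ->; rewrite addr0.
  apply/seteqP; split=> [y Ay|_ -> //]; by rewrite /= (Ap y Ay) (Ap x Ax).
exists x, 0%VS; split; first by rewrite dimv0.
apply/seteqP; split=> y.
  move=> [m [a [q [qx a1 ->]]]]; exists 0; first exact: mem0v.
  rewrite addr0.
  under eq_bigr do rewrite qx.
  by rewrite -scaler_suml a1 scale1r.
move=> [u /=]; rewrite memv0 => /eqP -> <-; rewrite addr0.
exact: affine_hull_sub.
Qed.

Lemma total_of_full (I : finType) (v : I -> 'rV[R]_d) :
  has_dim (convex_hull (range v)) d -> total v [set: I].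
Proof.
move=> /has_dim_full vT u uv; apply: dot_eq0 => x.
have : affine_hull (convex_hull (range v)) x by rewrite vT.
move=> [m [a [p [pv _ ->]]]]; rewrite dot_sumZl big1 // => s _.
have /hullP[b [_ _ ->]] := pv s; rewrite dot_sumZl big1 ?mulr0 // => i _.
by rewrite uv ?mulr0 // inE.
Qed.

Lemma vertex_face (I : finType) (v : I -> 'rV[R]_d) i a :
  (forall l, l != i -> dot (v l) a < dot (v i) a) ->
  faces (convex_hull (range v)) 0 [set v i].
Proof.
move=> va; split; last by apply/has_dim0; exists (v i).
have va' l : dot (v l) a <= dot (v i) a.
  by have [->|/va/ltW] := eqVneq l i.
exists a, (dot (v i) a); split; first exact: (hull_le (S := setT)).
rewrite (hull_face va') (_ : [set l | _] = [set i]); last first.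
  apply/seteqP; split=> [l /= e|l -> //]; apply/eqP; apply: contraT => /va.
  by rewrite e ltxx.
apply/seteqP; split=> [x ->|x].
  exact: hull_vertex.
move=> /hull_imageP[b [_ b1 -> bS]] /=.
have b0 l : l != i -> b l = 0 by move=> li; apply: contraNeq li => /bS ->.
move: b1; rewrite (bigD1 i) //= big1 // addr0 => bi1.
rewrite (bigD1 i) //= bi1 scale1r big1 ?addr0 // => l /b0 ->.
by rewrite scale0r.
Qed.

Lemma face_hull (I : finType) (v : I -> 'rV[R]_d) F :
  is_face (convex_hull (range v)) F -> exists S : set I, F = convex_hull (v @` S).
Proof.
move=> [a [c [ac ->]]]; exists [set i | dot (v i) a = c].
by apply: hull_face => i; apply: ac; exact: hull_vertex.
Qed.

Lemma face0_vertex (I : finType) (v : I -> 'rV[R]_d) F :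
  faces (convex_hull (range v)) 0 F -> exists i, F = [set v i].
Proof.
move=> [/face_hull[S ->] F0]; have [x Fx] := (has_dim0 _).1 F0.
have [_ [m [a [p [pS _ a1 _]]]]] := has_dim_nonempty F0.
case: m => [|m] in a p pS a1 *.
  by move/eqP: a1; rewrite big_ord0 eq_sym oner_eq0.
have [i Si _] := pS ord0; exists i; rewrite Fx.
have : convex_hull (v @` S) (v i) by exact: hull_vertex.
by rewrite Fx => ->.
Qed.

(* The vertices are found as a generating family of minimal size. *)
Lemma polytope_vertices (P : set 'rV[R]_d) : polytope P ->
  exists m (v : 'I_m -> 'rV[R]_d), P = convex_hull (range v) /\
    forall i, exists a, forall l, l != i -> dot (v l) a < dot (v i) a.
Proof.
move=> [V [m0 /card_eq_ordP[v0 _ V0]] PV].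
pose gen m := `[< exists v : 'I_m -> 'rV[R]_d, P = convex_hull (range v) >].
have gen0 : exists m, gen m by exists m0; apply/asboolP; exists v0; rewrite V0.
have [m /asboolP[v Pv] mmin] := ex_minnP gen0.
exists m, v; split=> // i; case: m v Pv mmin i => [|m] v Pv mmin i; first by case: i.
(* A generator in the hull of the others could be dropped, against minimality; otherwise separation
   exposes it. *)
case: (pselect (convex_hull (range (v \o lift i)) (v i))) => [vi|/separation[a va]].
  have /mmin : gen m; last by rewrite ltnn.
  apply/asboolP; exists (v \o lift i); rewrite Pv; apply/seteqP; split.
    apply: hull_trans => l; case: (unliftP i l) => [l'|] -> //.
    exact: (@hull_vertex _ _ _ (v \o lift i) setT).
  by apply: hull_trans => l; exact: hull_vertex.
exists a => l; case: (unliftP i l) => [l'|] ->; first by move=> _; exact: va.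
by rewrite eqxx.
Qed.

End Faces.

(** * Centrally symmetric polytopes *)

Section Symmetric.
Context {R : realType}.

Lemma cs_opp d (P : set 'rV[R]_d) x : centrally_symmetric P -> P x -> P (- x).
Proof. by move=> Ps; rewrite {1}Ps => -[y Py <-]; rewrite opprK. Qed.

(** Symmetry forces [c >= 0]. If [c = 0], then [a] vanishes on [P] and [F = P], which has the wrong
    dimension. *)
Lemma supporting_gt0 d (P F : set 'rV[R]_d) j a c : (j < d)%N ->
  has_dim P d -> centrally_symmetric P -> (forall x, P x -> dot x a <= c) ->
  F = P `&` [set x | dot x a = c] -> has_dim F j -> 0 < c.
Proof.
move=> jd Pd Ps ac FE Fj; have [x Fx] := has_dim_nonempty Fj.
have [Px /= xc] : P x /\ dot x a = c by rewrite FE in Fx.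
have c0 : 0 <= c by have := ac _ (cs_opp Ps Px); rewrite dotNl xc; lra.
rewrite lt_neqAle c0 andbT eq_sym; apply/eqP => c00.
have FP : F = P.
  rewrite FE; apply/seteqP; split=> [y []//|y Py]; split=> //=.
  have := ac _ (cs_opp Ps Py); have := ac _ Py; rewrite dotNl c00; lra.
by rewrite FP in Fj; rewrite (has_dim_proper Pd Fj) ltnn in jd.
Qed.

(** Dividing a supporting functional by its level [c > 0] assigns a tight set to each face, and the
    face is recovered from it as a convex hull. *)
Lemma card_faces_le k n j m (P : set 'rV[R]_(k + k)) : (j < k + k)%N ->
  cs_polytope n P -> faces P j #= `I_m ->
  (m <= 2 * 'C(n, k) * 2 ^ (k + k))%N.
Proof.
move=> jd [Pp Pd Ps Pn] Pm.
have [m0 [v [PE vex]]] := polytope_vertices Pp.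
have tv : total v [set: 'I_m0]%SET by apply: total_of_full; rewrite -PE.
have m0n : (m0 <= n)%N.
  rewrite -[m0]card_ord; apply: (card_ge_finType (h := fun i => [set v i]) Pn).
    move=> i i' e; apply/eqP; apply: contraT => ii'.
    have [a /(_ i ii')] := vex i'; have : [set v i'] (v i) by rewrite -e.
    by move=> /= ->; rewrite ltxx.
  by move=> i; have [a va] := vex i; rewrite PE; exact: vertex_face va.
apply: (@leq_trans (2 * 'C(m0, k) * 2 ^ (k + k))); last first.
  by rewrite leq_mul2r leq_mul2l leq_bin2l ?orbT.
have := card_tight_sets tv; rewrite card_ord; apply: leq_trans.
have /choice[h hP] (F : set 'rV[R]_(k + k)) : exists A : {set 'I_m0},
    faces P j F -> A \in tight_sets v /\ F = convex_hull (v @` [set` A]).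
  case: (pselect (faces P j F)) => [[[a [c [ac FE]]] Fj]|nF]; last by exists finset.set0.
  have c0 := supporting_gt0 jd Pd Ps ac FE Fj.
  have va i : dot (v i) a <= c by apply: ac; rewrite PE; exact: hull_vertex.
  exists [set i | dot (v i) (c^-1 *: a) == 1]%SET => _; split.
    rewrite inE; apply/asboolP; exists (c^-1 *: a) => // i.
    by rewrite dotZr mulrC ler_pdivrMr // mul1r.
  rewrite FE PE (hull_face va); congr (convex_hull (_ @` _)).
  apply/seteqP; split=> i /=; rewrite inE dotZr.
    by move=> ->; rewrite mulVf // gt_eqF.
  by move/eqP/(congr1 ( *%R c)); rewrite mulVKf ?gt_eqF // mulr1.
apply: (card_le_finType (h := h) Pm).
  move=> F F'; rewrite !in_setE => /hP[_ {2}->] /hP[_ {2}->] -> //.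
by move=> F /hP[].
Qed.

(** Negation permutes the vertices. A fixed vertex would be 0, with supporting level 0, against
    [supporting_gt0]. *)
Lemma cs_even d n (P : set 'rV[R]_d) : (0 < d)%N -> cs_polytope n P -> ~~ odd n.
Proof.
move=> d0 [_ Pd Ps /card_eq_ordP[g gI gP]].
have /choice[p gp] i : exists x, g i = [set x].
  have : faces P 0 (g i) by rewrite -gP; exists i.
  by move=> [_ /has_dim0].
have pI i i' : p i = p i' -> i = i' by move=> e; apply: gI; rewrite !gp e.
have fp i : is_face P [set p i].
  by rewrite -gp; have : faces P 0 (g i) by [rewrite -gP; exists i]; case.
have /choice[s sP] i : exists i', p i' = - p i.
  have : faces P 0 [set - p i].
    split; last by apply/has_dim0; exists (- p i).
    have [a [c [ac FE]]] := fp i; exists (- a), c; split.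
      by move=> x /(cs_opp Ps)/ac; rewrite -!/(dot _ _) dotNl dotNr.
    have [Pp pc] : (P `&` [set x | dot x a = c]) (p i) by rewrite -FE.
    apply/seteqP; split=> [x /= ->|x [Px xc]] /=.
      by split; [exact: cs_opp|rewrite -/(dot _ _) dotNl dotNr opprK].
    have : (P `&` [set x | dot x a = c]) (- x).
      by split; [exact: cs_opp|move: xc; rewrite /= -/(dot _ _) dotNr dotNl].
    by rewrite -FE => /= <-; rewrite opprK.
  rewrite -gP => -[i' _]; rewrite gp => e; exists i'.
  by have : [set p i'] (p i') by []; rewrite e.
apply: (@fixfree_involution_even n s) => [i|i].
  by apply: pI; rewrite !sP opprK.
apply/eqP => si; have := sP i; rewrite si => pN.
have p0 : p i = 0.
  by apply/rowP => l; move/rowP/(_ l): pN; rewrite !mxE; lra.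
have [a [c [ac FE]]] := fp i.
have := supporting_gt0 d0 Pd Ps ac FE; rewrite has_dim0.
move=> /(_ (ex_intro _ _ erefl)).
have [_ <-] : (P `&` [set x | dot x a = c]) (p i) by rewrite -FE.
by rewrite p0 dot0l ltxx.
Qed.

(** Up to scaling the [u s] are a dual system, so the [w s] are linearly independent and form a
    [j]-simplex. *)
Lemma has_dim_simplex d j (w : 'I_j.+1 -> 'rV[R]_d) (u : 'I_j.+1 -> 'cV[R]_d) :
  (forall s, dot (w s) (u s) != 0) ->
  (forall s t, s != t -> dot (w s) (u t) = 0) ->
  has_dim (convex_hull (range w)) j.
Proof.
move=> wu wu0; pose e (s : 'I_j) := w (lift ord0 s) - w ord0.
pose E : j.-tuple 'rV[R]_d := mktuple e; exists (w ord0), <<E>>%VS; split.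
  have /eqP : free E.
    apply/freeP => a; under eq_bigr do rewrite -tnth_nth tnth_mktuple.
    move=> a0 s; have := congr1 (fun x => dot x (u (lift ord0 s))) a0.
    rewrite dot0l dot_sumZl (bigD1 s) //= big1 => [|t ts]; last first.
      rewrite dotDl dotNl (wu0 (lift ord0 t)) ?(inj_eq lift_inj) //.
      by rewrite wu0 ?neq_lift // subrr mulr0.
    rewrite dotDl dotNl [dot (w ord0) _]wu0 // subr0 addr0 => /eqP.
    by rewrite mulf_eq0 (negbTE (wu _)) orbF => /eqP.
  by rewrite size_tuple.
apply/seteqP; split=> x.
  move=> [m [a [p [pw a1 ->]]]]; exists (\sum_s a s *: (p s - w ord0)).
    rewrite /=; apply: memv_suml => s _; apply: memvZ.
    have /hullP[b [_ b1 ->]] := pw s.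
    rewrite -[w ord0]scale1r -b1 scaler_suml -sumrB; apply: memv_suml => t _.
    rewrite -scalerBr; apply: memvZ; case: (unliftP ord0 t) => [t'|] ->.
      apply: memv_span; have := mem_tnth t' E; rewrite tnth_mktuple.
      exact.
    by rewrite subrr mem0v.
  under eq_bigr do rewrite scalerBr.
  by rewrite sumrB -scaler_suml a1 scale1r addrC subrK.
move=> [y /= /(coord_span (X := E)) yE <-]; pose b s := coord E s y.
pose c := 1 - \sum_s b s; pose b' (s : 'I_j.+1) := oapp b c (unlift ord0 s).
have b'0 : b' ord0 = c by rewrite /b' unlift_none.
have b'S s : b' (lift ord0 s) = b s by rewrite /b' liftK.
have -> : w ord0 + y = \sum_s b' s *: w s.
  rewrite big_ord_recl b'0; under [in RHS]eq_bigr do rewrite b'S.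
  rewrite scalerBl scale1r -addrA; congr (_ + _); rewrite {1}yE addrC.
  rewrite scaler_suml -sumrB; apply: eq_bigr => s _.
  by rewrite -scalerBr -tnth_nth tnth_mktuple.
apply: hull_affine_hull; rewrite big_ord_recl b'0.
by under eq_bigr do rewrite b'S; rewrite subrK.
Qed.

(** As 0 is an affine combination of the generators, adding a multiple of it corrects any linear
    combination to coefficient sum 1. *)
Lemma has_dim_total d (I : finType) (v : I -> 'rV[R]_d) :
  total v [set: I]%SET -> convex_hull (range v) 0 ->
  has_dim (convex_hull (range v)) d.
Proof.
move=> tv /hullP[b [_ b1 b0]]; apply/has_dim_full/seteqP; split=> // x _.
have [lam ->] := total_span x tv.
have -> : \sum_(i in [set: I]%SET) lam i *: v i =
    \sum_i (lam i + (1 - \sum_l lam l) * b i) *: v i.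
  under [RHS]eq_bigr do rewrite scalerDl -scalerA.
  rewrite big_split /= -scaler_sumr -b0 scaler0 addr0.
  by apply: eq_bigl => i; rewrite inE.
apply: hull_affine_hull; rewrite big_split /= -mulr_sumr b1 mulr1.
by rewrite addrC subrK.
Qed.

End Symmetric.

(** * Direct sums of polygons *)

Section PolygonSum.
Context {R : realType} {k N : nat}.
Hypothesis k_gt0 : (0 < k)%N.

Let M2 : R := N%:R ^+ 2.

(** The point with abscissa [x] on the parabola [y = N^2 - x^2] in the [i]-th plane; the halves of
    the row hold abscissas and ordinates. *)
Definition pt (i : 'I_k) (x : nat) : 'rV[R]_(k + k) :=
  row_mx (x%:R *: delta_mx 0 i) ((M2 - x%:R ^+ 2) *: delta_mx 0 i).

Definition block (l : nat) : 'I_k := Ordinal (ltn_pmod l k_gt0).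

(** The index modulo [k] selects the plane and the quotient the abscissa, which spreads any number
    [N] of points almost evenly; the boolean selects the antipode. *)
Definition vtx (t : bool * 'I_N) : 'rV[R]_(k + k) :=
  (-1) ^+ t.1 *: pt (block t.2) (t.2 %/ k).

(* On the block [i] with [h i], this is the affine line through the points of
   the parabola with abscissas [f i] and [f' i], or the tangent if they agree,
   normalized to have value 1 there. *)
Definition chord (h : 'I_k -> bool) (f f' : 'I_k -> nat) : 'cV[R]_(k + k) :=
  col_mx (\col_i ((h i)%:R * (f i + f' i)%:R / (M2 + (f i * f' i)%:R)))
    (\col_i ((h i)%:R / (M2 + (f i * f' i)%:R))).

Lemma dot_pt i x (u1 u2 : 'cV[R]_k) :
  dot (pt i x) (col_mx u1 u2) = x%:R * u1 i 0 + (M2 - x%:R ^+ 2) * u2 i 0.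
Proof. by rewrite /dot mul_row_col -!scalemxAl -!rowE !mxE. Qed.

Lemma dot_vtx t a : dot (vtx t) a = (-1) ^+ t.1 * dot (pt (block t.2) (t.2 %/ k)) a.
Proof. by rewrite dotZl. Qed.

Lemma vtx_neg b l : vtx (~~ b, l) = - vtx (b, l).
Proof. by rewrite /vtx; case: b; rewrite /= ?expr0 ?expr1 ?scale1r ?scaleN1r ?opprK. Qed.

Lemma dot_chord h f f' i x : (0 < N)%N ->
  dot (pt i x) (chord h f f') = (h i)%:R *
    (1 - (x%:R - (f i)%:R) * (x%:R - (f' i)%:R) / (M2 + (f i * f' i)%:R)).
Proof.
move=> N0; have D0 : M2 + (f i * f' i)%:R != 0.
  by rewrite gt_eqF // ltr_wpDr ?ler0n // exprn_gt0 // ltr0n.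
rewrite dot_pt !mxE; move: D0; rewrite !natrM !natrD => D0; by field.
Qed.

Lemma index_lt (t : bool * 'I_N) : (t.2 %/ k < N)%N.
Proof. exact: leq_ltn_trans (leq_div _ _) (ltn_ord t.2). Qed.

(** No integer lies strictly between [f i] and [f' i], so [0 <= q], with equality only at these two;
    also [q < D]. Hence [1 - q / D] is positive and at most 1, antipodes get negative values, and
    blocks without [h] get 0. *)
Lemma chord_le1 h f f' t : (forall i, f' i = f i \/ f' i = (f i).+1) ->
  dot (vtx t) (chord h f f') <= 1 ?= iff [&& ~~ t.1, h (block t.2) &
    (t.2 %/ k == f (block t.2))%N || (t.2 %/ k == f' (block t.2))%N].
Proof.
move=> ff'; have N0 : (0 < N)%N by case: t => _ [l lN] /=; lia.
rewrite dot_vtx dot_chord //; set i := block t.2; set x := (t.2 %/ k)%N.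
set D := M2 + _; pose q : R := (x%:R - (f i)%:R) * (x%:R - (f' i)%:R).
have xN : (x%:R : R) < N%:R by rewrite ltr_nat index_lt.
have x0 : (0 : R) <= x%:R by exact: ler0n.
have fD : D = M2 + (f i)%:R * (f' i)%:R by rewrite /D natrM.
have f0 : (0 : R) <= (f i)%:R by exact: ler0n.
have f'0 : (0 : R) <= (f' i)%:R by exact: ler0n.
have M0 : x%:R ^+ 2 < M2 by rewrite /M2; nra.
have D0 : 0 < D by rewrite fD; nra.
have qD : q < D by rewrite fD /q; nra.
have q0 : 0 <= q ?= iff ((x == f i) || (x == f' i)).
  split; last first.
    by rewrite eq_sym /q mulf_eq0 !subr_eq0 !eqr_nat.
  rewrite /q; case: (ff' i) => ->; first by rewrite -expr2 sqr_ge0.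
  case: (leqP x (f i)) => xf.
    rewrite mulr_le0 // subr_le0 ler_nat //; lia.
  by rewrite mulr_ge0 // subr_ge0 ler_nat // ltnW.
rewrite -/q; case: (h i); rewrite ?mul0r ?mulr0 ?mul1r; last first.
  by split; rewrite ?andbF ?ler01 // eq_sym oner_eq0.
have q1 : q / D < 1 by rewrite ltr_pdivrMr // mul1r.
have qD0 : 0 <= q / D by exact: divr_ge0 q0.1 (ltW D0).
case: t.1 => /=; rewrite ?expr1 ?expr0 ?mul1r ?mulN1r.
  split; first by lra.
  by apply/negbTE/eqP; lra.
split; first by lra.
rewrite -q0.2 -subr_eq0 addrAC subrr add0r oppr_eq0 mulf_eq0 invr_eq0.
by rewrite (gt_eqF D0) orbF eq_sym.
Qed.

Definition polygon_sum := convex_hull (range vtx).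

(** The tangent at the vertex, extended by 0 to the other planes and taken with the sign of the
    vertex, exposes it. *)
Lemma vtx_exposed t : exists a, forall t', t' != t -> dot (vtx t') a < dot (vtx t) a.
Proof.
case: t => b l; pose f (i : 'I_k) := (l %/ k)%N.
pose c := chord (fun i => i == block l) f f.
have sgn t' : dot (vtx t') ((-1) ^+ b *: c) = dot (vtx (t'.1 (+) b, t'.2)) c.
  by rewrite dotZr !dot_vtx signr_addb mulrA [(-1) ^+ b * _]mulrC.
have le t' := chord_le1 (fun i => i == block l) t' (fun i => or_introl (erefl (f i))).
exists ((-1) ^+ b *: c) => -[b' l'] tt'; rewrite !sgn /= addbb.
have -> : dot (vtx (false, l)) c = 1.
  by apply/eqP; rewrite (le (false, l)).2 /= !eqxx.
rewrite lt_neqAle (le (b' (+) b, l')).1 andbT (le (b' (+) b, l')).2 /=.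
apply: contra tt' => /and3P[bb' /eqP ll' lk].
rewrite -(addbK b b') (negbTE bb') addFb; apply/eqP; congr (_, _).
apply: val_inj; rewrite /= (divn_eq l k) (divn_eq l' k).
have -> : (l' %% k = l %% k)%N by move/(congr1 val): ll'.
by move: lk; rewrite orbb => /eqP ->.
Qed.

Lemma vtx_inj : injective vtx.
Proof.
move=> t t' e; apply/eqP; apply: contraT => /[dup] tt'.
by have [a h] := vtx_exposed t' => /h; rewrite e ltxx.
Qed.

Lemma polygon_sum_cs : centrally_symmetric polygon_sum.
Proof.
have opp x : polygon_sum x -> polygon_sum (- x).
  move=> /hullP[a [a0 a1 ->]]; apply/hullP.
  pose s (t : bool * 'I_N) := (~~ t.1, t.2).
  have sK : involutive s by case=> b l; rewrite /s /= negbK.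
  exists (a \o s); split=> [t||].
  - exact: a0.
  - by rewrite -a1 [RHS](reindex_inj (inv_inj sK)).
  - rewrite [in LHS](reindex_inj (inv_inj sK)) /= -sumrN; apply: eq_bigr => -[b l] _.
    by rewrite /= vtx_neg scalerN opprK.
apply/seteqP; split=> [x Px|_ [x Px <-]]; last exact: opp.
by exists (- x); [exact: opp|rewrite opprK].
Qed.

Lemma polygon_sum0 : (0 < N)%N -> polygon_sum 0.
Proof.
move=> N0; pose l := Ordinal N0.
have vP b : polygon_sum (vtx (b, l)) by exact: hull_vertex.
apply/hullP; exists (fun t => 2%:R^-1 * (t.2 == l)%:R); split.
- by move=> t; rewrite mulr_ge0 ?ler0n // invr_ge0 ler0n.
- rewrite -(pair_bigA _ (fun b (i : 'I_N) => 2%:R^-1 * (i == l)%:R)) /=.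
  have l1 : \sum_(i < N) (i == l)%:R = 1 :> R.
    by rewrite (bigD1 l) //= ?eqxx big1 ?addr0 // => i /negbTE ->.
  by rewrite big_bool /= -!mulr_sumr l1; lra.
- rewrite -(pair_bigA _ (fun b (i : 'I_N) => (2%:R^-1 * (i == l)%:R) *: vtx (b, i))).
  rewrite big_bool /= -big_split big1 //= => i _.
  by rewrite (vtx_neg false) scalerN addNr.
Qed.

Lemma exists_index i x : (x * k + i < N)%N -> (i < k)%N ->
  exists2 l : 'I_N, (l %% k = i)%N & (l %/ k = x)%N.
Proof.
move=> h ik; exists (Ordinal h) => /=; first by rewrite modnMDl modn_small.
by rewrite divnMDl // divn_small // addn0.
Qed.

Lemma exists_vtx (i : 'I_k) x : (x < N %/ k)%N ->
  exists l : 'I_N, [/\ block l = i, (l %/ k)%N = x & vtx (false, l) = pt i x].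
Proof.
move=> xN; have [|//|l li lx] := @exists_index i x.
  have := leq_trunc_div N k; have := ltn_ord i.
  have : (x.+1 * k <= N %/ k * k)%N by rewrite leq_mul2r xN orbT.
  rewrite mulSn; lia.
have bl : block l = i by exact: val_inj.
by exists l; split; rewrite // /vtx /= bl lx expr0 scale1r.
Qed.

(** Abscissas 0 and 1 already span each plane, and [2 * k <= N] puts both into every block. *)
Lemma vtx_total : (2 * k <= N)%N -> total vtx [set: bool * 'I_N]%SET.
Proof.
move=> kN u uv; have N2 : (2 <= N %/ k)%N by rewrite leq_divRL.
have up i x : (x < 2)%N -> dot (pt i x) u = 0.
  move=> x2; have [l [_ _ <-]] := @exists_vtx i x (leq_trans x2 N2).
  by apply: uv; rewrite inE.
have M0 : M2 != 0 by rewrite expf_neq0 // pnatr_eq0; lia.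
rewrite -[u]vsubmxK in up *; move: (usubmx u) (dsubmx u) up => u1 u2 up.
have u20 i : u2 i 0 = 0.
  have := up i 0%N isT; rewrite dot_pt mul0r add0r expr0n subr0 => /eqP.
  by rewrite mulf_eq0 (negbTE M0) => /eqP.
have u10 i : u1 i 0 = 0.
  by have := up i 1%N isT; rewrite dot_pt u20 mulr0 addr0 mul1r.
have -> : u1 = 0 by apply/colP => i; rewrite u10 mxE.
have -> : u2 = 0 by apply/colP => i; rewrite u20 mxE.
by rewrite col_mx0.
Qed.

Lemma cs_polytope_polygon_sum : (2 * k <= N)%N ->
  cs_polytope (2 * N) polygon_sum.
Proof.
move=> kN; split.
- exists (range vtx) => //; exact/finite_image/finite_finset.
- by apply: has_dim_total; [exact: vtx_total|apply: polygon_sum0; lia].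
- exact: polygon_sum_cs.
- have -> : (2 * N)%N = #|{: bool * 'I_N}| by rewrite card_prod card_bool card_ord.
  have -> : faces polygon_sum 0 = range (fun t => [set vtx t]).
    apply/seteqP; split=> [F /face0_vertex[t ->]|_ [t _ <-]]; first by exists t.
    by have [a] := vtx_exposed t; exact: vertex_face.
  apply: card_range => t t' e; apply: vtx_inj.
  by have : [set vtx t'] (vtx t) by rewrite -e.
Qed.

(* A [j]-face is the join of an edge in each of the blocks [i < j + 1 - k] and of
   a vertex in each other block. *)
Lemma polygon_sum_faces j m : (k <= j)%N -> (j < 2 * k)%N ->
  faces polygon_sum j #= `I_m -> ((N %/ k).-1 ^ k <= m)%N.
Proof.
(* Each block contains all abscissas below [N %/ k], hence [n] pairs of consecutive ones. *)
move=> kj jk Pm; set n := (N %/ k).-1.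
pose f (F : {ffun 'I_k -> 'I_n}) (i : 'I_k) : nat := F i.
pose f' F (i : 'I_k) : nat := (f F i + (i + k <= j))%N.
have ff' F i : f' F i = f F i \/ f' F i = (f F i).+1.
  by rewrite /f'; case: (_ <= _)%N; rewrite ?addn0 ?addn1; [right|left].
have fn F i : ((f F i).+1 < N %/ k)%N by have := ltn_ord (F i); rewrite /f /n; lia.
pose a F := chord xpredT (f F) (f' F).
pose G F := polygon_sum `&` [set x | dot x (a F) = 1].
have va F t := chord_le1 xpredT t (ff' F).
have memG F i : dot (pt i (f F i)) (a F) = 1.
  have [l [li lx <-]] := @exists_vtx i (f F i) (ltnW (fn F i)).
  by apply/eqP; rewrite (va F (false, l)).2 /= li lx eqxx.
rewrite -[n]card_ord -[k in (_ ^ k)%N]card_ord -card_ffun.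
apply: (card_ge_finType (h := G) Pm).
  move=> F F' e.
  (* Each face contains the chosen vertices of the other, and two numbers cannot each be the
     successor of the other. *)
  have key F1 F2 i : G F1 = G F2 -> (f F1 i == f F2 i) || (f F1 i == f' F2 i).
    move=> e12; have [l [li lx lp]] := @exists_vtx i (f F1 i) (ltnW (fn F1 i)).
    have : G F1 (vtx (false, l)).
      by split; [exact: hull_vertex|rewrite lp /= memG].
    by rewrite e12 => -[_ /= /eqP]; rewrite (va F2 (false, l)).2 /= li lx.
  apply/ffunP => i; apply: val_inj; have := key F F' i e; have := key F' F i (esym e).
  rewrite /f' /f /=; move: (F i : nat) (F' i : nat) => x y; case: (_ <= _)%N => /=; lia.
move=> F; split.
  exists (a F), 1; split=> // x; apply: (hull_le (S := setT)) => t _; exact: (va F t).1.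
rewrite /G hull_face; last by move=> t; exact: (va F t).1.
(* Index [s < k] stands for the first point in block [s], index [s >= k] for the second point in
   block [s - k]. *)
pose bl (s : 'I_j.+1) := block s.
pose w (s : 'I_j.+1) := pt (bl s) (f F (bl s) + (k <= s))%N.
(* [g s] is the abscissa of the other point of the consecutive pair, and [u s] vanishes at that
   point and on all other planes. This yields the dual system. *)
pose g (s : 'I_j.+1) : R := (f F (bl s) + (s < k))%:R.
pose u (s : 'I_j.+1) : 'cV[R]_(k + k) :=
  col_mx ((g s ^+ 2 - M2) *: delta_mx (bl s) 0) (g s *: delta_mx (bl s) 0).
have wu s t : dot (w s) (u t) = (bl s == bl t)%:R *
    ((M2 + (f F (bl s) + (k <= s))%:R * g t) * (g t - (f F (bl s) + (k <= s))%:R)).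
  rewrite dot_pt !mxE eqxx andbT; ring.
have -> : vtx @` [set t | dot (vtx t) (a F) = 1] = range w.
  apply/seteqP; split=> [_ [[b l] /= /eqP + <-]|_ [s _ <-]].
    rewrite (va F (b, l)).2 /= => /andP[/negbTE -> lf].
    have e : exists2 s : 'I_j.+1, bl s = block l & (f F (bl s) + (k <= s))%N = (l %/ k)%N.
      have lk := ltn_pmod l k_gt0.
      case/orP: lf => /eqP lf.
        have h : (l %% k < j.+1)%N by lia.
        have bE : bl (Ordinal h) = block l by apply: val_inj; rewrite /= modn_mod.
        by exists (Ordinal h); rewrite // bE /= leqNgt lk addn0.
      move: lf; rewrite /f' /=; case: (leqP _ j) => h lf.
        have h' : (l %% k + k < j.+1)%N by [].
        have bE : bl (Ordinal h') = block l.
          by apply: val_inj; rewrite /= modnDr modn_mod.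
        by exists (Ordinal h'); rewrite // bE /= leq_addl.
      have h' : (l %% k < j.+1)%N by lia.
      have bE : bl (Ordinal h') = block l by apply: val_inj; rewrite /= modn_mod.
      by exists (Ordinal h'); rewrite // bE /= leqNgt lk.
    by case: e => s sb sx; exists s => //; rewrite /w sx sb /vtx /= expr0 scale1r.
  have [|l [lb lx lp]] := @exists_vtx (bl s) (f F (bl s) + (k <= s)).
    by have := fn F (bl s); case: (k <= s)%N => /=; lia.
  exists (false, l) => //=; apply/eqP; rewrite (va F (false, l)).2 /= lb lx /f' /=.
  case: (leqP k s) => ks; last by rewrite addn0 eqxx.
  have -> : (s %% k + k <= j)%N.
    have sk : (s < k + k)%N by have := ltn_ord s; lia.
    by rewrite -{1}(subnK ks) modnDr modn_small; have := ltn_ord s; lia.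
  by rewrite eqxx orbT.
apply: (@has_dim_simplex _ _ _ w u) => [s|s t st]; rewrite wu.
  rewrite eqxx mul1r mulf_neq0 //.
    rewrite gt_eqF // ltr_wpDr ?mulr_ge0 ?ler0n // exprn_gt0 // ltr0n.
    have := fn F (bl s); have := leq_div N k; lia.
  by rewrite subr_eq0 eqr_nat; case: leqP; rewrite ?addn0 ?addn1; lia.
case: eqP => [e|_]; last by rewrite mul0r.
(* Distinct indices in one block differ by [k] because [j < 2 * k], so [g t] is the abscissa of
   [w s]. *)
have -> : g t = (f F (bl s) + (k <= s))%:R; last by rewrite subrr !mulr0.
rewrite /g -e; congr (_ + _)%:R; congr nat_of_bool.
have {}e : (s %% k = t %% k)%N by move/(congr1 val): e.
have sj := ltn_ord s; have tj := ltn_ord t.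
have st' : (s : nat) != t by [].
have small x : (x < j.+1)%N -> (x %% k)%N = if (x < k)%N then x else (x - k)%N.
  move=> xj; case: ltnP => xk; first by rewrite modn_small.
  by rewrite -{1}(subnK xk) modnDr modn_small //; lia.
by move: e; rewrite !small //; case: (ltnP s k); case: (ltnP t k); lia.
Qed.

End PolygonSum.

(** * Bounds on fmax *)

Section Fmax.
Context {R : realType}.

Lemma finite_faces d (I : finType) (v : I -> 'rV[R]_d) j :
  finite_set (faces (convex_hull (range v)) j).
Proof.
apply: (@sub_finite_set _ _
  (range (fun A : {set I} => convex_hull (v @` [set` A])))).
  move=> F [/face_hull[S ->] _]; exists [set i | `[< S i >]]%SET => //.
  congr (convex_hull (_ @` _)); apply/seteqP.
  by split=> i /=; rewrite inE => /asboolP.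
exact/finite_image/finite_finset.
Qed.

(** The polygon sum makes the set of face numbers nonempty and the upper bound makes it bounded, so
    [fmax] is a true maximum and not the default 0. *)
Lemma fmax_bounds k N j : (0 < k)%N -> (k <= j)%N -> (j < 2 * k)%N ->
  (2 * k <= N)%N ->
  ((N %/ k).-1 ^ k <= fmax R (k + k) (2 * N) j)%N /\
  (fmax R (k + k) (2 * N) j <= 2 * 'C(2 * N, k) * 2 ^ (k + k))%N.
Proof.
move=> k0 kj jk kN; pose P : set 'rV[R]_(k + k) := @polygon_sum R k N k0.
have Pcs : cs_polytope (2 * N) P := cs_polytope_polygon_sum k0 kN.
have [m Pm] : finite_set (faces P j) by exact: finite_faces.
have ub m' : face_numbers R (k + k) (2 * N) j m' ->
    (m' <= 2 * 'C(2 * N, k) * 2 ^ (k + k))%N.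
  by move=> [P' P'cs P'm]; apply: card_faces_le P'cs P'm; lia.
have Pf : face_numbers R (k + k) (2 * N) j m by exists P.
pose p m' := `[< face_numbers R (k + k) (2 * N) j m' >].
have [||M /asboolP pM Mmax] := @ex_maxnP p (2 * 'C(2 * N, k) * 2 ^ (k + k)).
- by exists m; apply/asboolP.
- by move=> m' /asboolP /ub.
have [fm fmx] : face_numbers R (k + k) (2 * N) j (fmax R (k + k) (2 * N) j) /\
    forall m', face_numbers R (k + k) (2 * N) j m' ->
      (m' <= fmax R (k + k) (2 * N) j)%N.
  apply: (xgetPex 0%N (P := [set m | face_numbers R (k + k) (2 * N) j m /\
    forall m', face_numbers R (k + k) (2 * N) j m' -> (m' <= m)%N])).
  by exists M; split=> // m' m'f; apply: Mmax; apply/asboolP.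
split; last exact: ub.
by apply: leq_trans (fmx _ Pf); exact: polygon_sum_faces Pm.
Qed.

End Fmax.

Lemma bin_le_expn n k : ('C(n, k) <= n ^ k)%N.
Proof.
apply: (@leq_trans (n ^_ k)); first by rewrite -bin_ffact leq_pmulr ?fact_gt0.
elim: k => // k IH; rewrite ffactnSr expnSr.
by rewrite leq_mul // leq_subr.
Qed.

Theorem theorem7p1 (R : realType) (d k j : nat) (hk : (0 < k)%N)
    (hd : d = (2 * k)%N) (hkj : (k <= j)%N) (hj : (j < 2 * k)%N) :
  exists gamma Gamma : R, [/\ 0 < gamma, 0 < Gamma &
    exists e E : nat -> R,
      [/\ e n @[n --> \oo] --> 0, E n @[n --> \oo] --> 0 &
        \forall n \near \oo,
          (exists P : set 'rV[R]_d, cs_polytope n P) ->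
          gamma + e n <= (fmax R d n j)%:R / 'C(n, k)%:R <= Gamma + E n]].
Proof.
have {hd} hd : d = (k + k)%N by rewrite hd mul2n addnn.
subst d; exists ((6 * k) ^ k)%:R^-1, (2 * 2 ^ (k + k))%:R; split.
- by rewrite invr_gt0 ltr0n expn_gt0 muln_gt0 hk.
- by rewrite ltr0n muln_gt0 expn_gt0.
(* Both bounds hold exactly once [n >= 4k], so the error terms are 0. *)
exists (fun=> 0), (fun=> 0); split; [exact: cvg_cst|exact: cvg_cst|].
near=> n => -[P Pn]; rewrite !addr0.
have n4 : (4 * k <= n)%N by near: n; exact: nbhs_infty_ge.
have nE : n = (2 * n./2)%N.
  rewrite mul2n -[LHS]odd_double_half; have d0 : (0 < k + k)%N by lia.
  by rewrite (negbTE (cs_even d0 Pn)).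
have N2 : (2 * k <= n./2)%N by lia.
have [lo up] := @fmax_bounds R k n./2 j hk hkj hj N2; rewrite -nE in lo up.
have C0 : (0 : R) < 'C(n, k)%:R by rewrite ltr0n bin_gt0; lia.
apply/andP; split; last by rewrite ler_pdivrMr // -natrM ler_nat mulnAC.
rewrite ler_pdivlMr // ler_pdivrMl ?ltr0n ?expn_gt0 ?muln_gt0 ?hk //.
rewrite -natrM ler_nat; apply: leq_trans (bin_le_expn n k) _.
apply: leq_trans (leq_mul (leqnn _) lo); rewrite -expnMn leq_exp2r //.
(* Source of the constant [6 * k]: for [m = n./2 %/ k >= 2] one has [m + 1 <= 3 (m - 1)], hence
   [n <= 2 (m + 1) k <= 6 k (m - 1)]. *)
have m2 : (2 <= n./2 %/ k)%N by rewrite leq_divRL.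
have := ltn_ceil n./2 hk; move: (n./2 %/ k)%N m2 => m m2 nm.
rewrite nE; apply: leq_trans (_ : 2 * (m.+1 * k) <= _)%N.
  by rewrite leq_mul2l ltnW.
have : (m.+1 <= 3 * m.-1)%N by lia.
by move/(leq_mul (leqnn (2 * k))); lia.
Unshelve. all: by end_near.
Qed.
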